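(* Let $p$ be a prime and let $K$ be a local field, finite over $\mathbb{Q}_p$, with prime $\mathfrak{q}_K\mid p$ and absolute ramification index $1$. Let $E_{/K}$ be an elliptic curve with a non-trivial $K$-rational $p$-torsion point. Then $E$ cannot have additive reduction at $\mathfrak{q}_K$, unless $p=2,3,5$ or $7$.
   Context: Absolute ramification index $1$ means that $K/\mathbb{Q}_p$ is unramified. *)

(* Defs.v *)
From HB Require Import structures.
From mathcomp Require Import all_boot all_order all_algebra all_field.
From mathcomp Require Import ring_quotient generic_quotient.

Set Implicit Arguments.
Unset Strict Implicit.
Unset Printing Implicit Defensive.

Import Order.TTheory GRing.Theory Num.Theory.
Local Open Scope ring_scope.
Local Open Scope quotient_scope.

(* The value of a valuation at 0 is meaningless (it stands for +oo), so every
   clause below that mentions a value treats 0 separately. *)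
Record valuation (F : fieldType) := Valuation {
  valuation_fun :> F -> int;
  valuationM : forall x y : F, x != 0 -> y != 0 ->
    valuation_fun (x * y) = valuation_fun x + valuation_fun y;
  valuationD : forall x y : F, x != 0 -> y != 0 -> x + y != 0 ->
    Num.min (valuation_fun x) (valuation_fun y) <= valuation_fun (x + y)
}.

Section ValuationRing.

Variables (F : fieldType) (v : valuation F).

Lemma valuation1 : v 1 = 0.
Proof.
have h := valuationM v (oner_neq0 F) (oner_neq0 F).
by rewrite mulr1 in h; apply: (addrI (v 1)); rewrite addr0.
Qed.

Lemma valuationN x : v (- x) = v x.
Proof.
have [->|x0] := eqVneq x 0; first by rewrite oppr0.
have N10 : (-1 : F) != 0 by rewrite oppr_eq0 oner_neq0.
have h : v (-1) = 0.
  have := valuationM v N10 N10; rewrite mulrNN mulr1 valuation1 => /eqP.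
  by rewrite eq_sym -mulr2n mulrn_eq0 /= => /eqP.
by rewrite -mulN1r valuationM // h add0r.
Qed.

Lemma valuationV x : x != 0 -> v x^-1 = - v x.
Proof.
move=> x0; have := valuationM v x0 (invr_neq0 x0).
by rewrite divff // valuation1 => /esym/eqP; rewrite addrC addr_eq0 => /eqP.
Qed.

Definition vint_pred : {pred F} := fun x => (x == 0) || (0 <= v x).

Lemma vint_subring : subring_closed vint_pred.
Proof.
rewrite /vint_pred; split=> [|x y|x y]; rewrite ?unfold_in /=.
- by rewrite valuation1 lexx orbT.
- have [->|x0] := eqVneq x 0; first by rewrite sub0r oppr_eq0 valuationN.
  have [->|y0] := eqVneq y 0; first by rewrite subr0 (negPf x0).
  rewrite /= => vx vy; have [//|xy0] := eqVneq (x - y) 0.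
  have Ny0 : - y != 0 by rewrite oppr_eq0.
  apply: le_trans (valuationD v x0 Ny0 xy0).
  by rewrite valuationN le_min vx vy.
- have [->|x0] := eqVneq x 0; first by rewrite mul0r eqxx.
  have [->|y0] := eqVneq y 0; first by rewrite mulr0 eqxx.
  by rewrite /= => vx vy; rewrite valuationM // addr_ge0 ?orbT.
Qed.

HB.instance Definition _ := GRing.isSubringClosed.Build F vint_pred vint_subring.

Record vring := VRing { vring_val :> F; vring_valP : vring_val \in vint_pred }.

HB.instance Definition _ := [isSub for vring_val].
HB.instance Definition _ := [Choice of vring by <:].
HB.instance Definition _ := [SubChoice_isSubComNzRing of vring by <:].

Definition vmax_pred : {pred vring} :=
  fun x => (val x == 0) || (0 < v (val x)).

Lemma vmax_idealr : idealr_closed vmax_pred.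
Proof.
split; rewrite ?unfold_in /=.
- by rewrite /vmax_pred /= eqxx.
- by rewrite /vmax_pred /= oner_eq0 valuation1 ltxx.
move=> a x y mx my.
have max : (val a * val x == 0) || (0 < v (val a * val x)).
  have [->|a0] := eqVneq (val a) 0; first by rewrite mul0r eqxx.
  move: mx; rewrite unfold_in /vmax_pred.
  have [->|x0] := eqVneq (val x) 0; first by rewrite mulr0 eqxx.
  have := vring_valP a; rewrite unfold_in /vint_pred (negPf a0) /= => va vx.
  by rewrite valuationM // ltr_wpDl ?orbT.
move: max my; rewrite !unfold_in /vmax_pred.
change (val (a * x + y)) with (val a * val x + val y).
have [->|axn] := eqVneq (val a * val x) 0; first by rewrite add0r.
have [->|yn] := eqVneq (val y) 0; first by rewrite addr0 (negPf axn).
rewrite /= => v1 v2; have [//|s0] := eqVneq (val a * val x + val y) 0.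
by apply: lt_le_trans (valuationD v axn yn s0); rewrite lt_min v1 v2.
Qed.

HB.instance Definition _ := isIdealr.Build vring vmax_pred vmax_idealr.

Definition residue_field := {ideal_quot vmax_pred}.

HB.instance Definition _ := GRing.ComNzRing.on residue_field.

Definition residue (x : vring) : residue_field := \pi_{ideal_quot vmax_pred} x.

HB.instance Definition _ := GRing.RMorphism.copy residue
  (\pi_{ideal_quot vmax_pred} : vring -> {ideal_quot vmax_pred}).

Definition residue_inv (a : residue_field) : residue_field :=
  if a == 0 then 0 else residue (insubd 0 (val (repr a))^-1).

Lemma residue_mulVf a : a != 0 -> residue_inv a * a = 1.
Proof.
rewrite /residue_inv => a0; rewrite (negPf a0).
have aE : a = residue (repr a) by rewrite /residue reprK.
have : ~~ vmax_pred (repr a).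
  apply: contra a0 => ma; rewrite aE /residue.
  by rewrite piE Quotient.equivE subr0.
rewrite /vmax_pred negb_or -leNgt => /andP[r0 vr].
have vVr : (val (repr a))^-1 \in vint_pred.
  by rewrite unfold_in /vint_pred valuationV // oppr_ge0 vr orbT.
rewrite [X in _ * X]aE -rmorphM -(rmorph1 residue).
by congr residue; apply: val_inj; rewrite /= insubdK // mulVf.
Qed.

Lemma residue_inv0 : residue_inv 0 = 0.
Proof. by rewrite /residue_inv eqxx. Qed.

HB.instance Definition _ :=
  GRing.ComNzRing_isField.Build residue_field residue_mulVf residue_inv0.

End ValuationRing.

Definition normalized (F : fieldType) (v : valuation F) : Prop :=
  forall n : int, exists2 x : F, x != 0 & v x = n.

Definition padic_val (p : nat) (q : rat) : int :=
  (logn p `|numq q|)%:Z - (logn p `|denq q|)%:Z.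

Definition vclose (F : fieldType) (v : valuation F) (n : int) (x y : F) : Prop :=
  x != y -> n <= v (x - y).

Definition vcauchy (F : fieldType) (v : valuation F) (u : nat -> F) : Prop :=
  forall n : int, exists N : nat, forall i j : nat,
    (N <= i)%N -> (N <= j)%N -> vclose v n (u i) (u j).

Definition vconverges (F : fieldType) (v : valuation F) (u : nat -> F) (l : F)
    : Prop :=
  forall n : int, exists N : nat, forall i : nat,
    (N <= i)%N -> vclose v n (u i) l.

(* A field of p-adic numbers, as the completion of rat for the p-adic
   valuation; this determines it up to a unique isometric isomorphism. *)
Record padicField (p : nat) := PadicField {
  padic_sort :> fieldType;
  padic_valuation : valuation padic_sort;
  padic_of_rat : {rmorphism rat -> padic_sort};
  padic_of_rat_val : forall q : rat, q != 0 ->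
    padic_valuation (padic_of_rat q) = padic_val p q;
  padic_dense : forall (x : padic_sort) (n : int),
    exists q : rat, vclose padic_valuation n (padic_of_rat q) x;
  padic_complete : forall u : nat -> padic_sort,
    vcauchy padic_valuation u -> exists l, vconverges padic_valuation u l
}.

(* For the normalized valuation vK of a finite extension K of the p-adic
   field, e is then the absolute ramification index of K. *)
Definition has_ramification_index (p : nat) (Qp : padicField p)
    (K : fieldExtType Qp) (vK : valuation K) (e : nat) : Prop :=
  forall x : Qp, x != 0 -> vK (x%:A) = e%:Z * padic_valuation Qp x.

(* y^2 + a1 x y + a3 y = x^3 + a2 x^2 + a4 x + a6 *)
Record weierstrass (R : Type) :=
  Weierstrass { wa1 : R; wa2 : R; wa3 : R; wa4 : R; wa6 : R }.

Definition map_weierstrass (R S : Type) (f : R -> S) (W : weierstrass R)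
    : weierstrass S :=
  Weierstrass (f (wa1 W)) (f (wa2 W)) (f (wa3 W)) (f (wa4 W)) (f (wa6 W)).

Section WeierstrassRing.

Variables (R : comNzRingType) (W : weierstrass R).

Local Notation a1 := (wa1 W).
Local Notation a2 := (wa2 W).
Local Notation a3 := (wa3 W).
Local Notation a4 := (wa4 W).
Local Notation a6 := (wa6 W).

Definition wb2 : R := a1 ^+ 2 + 4 * a2.
Definition wb4 : R := 2 * a4 + a1 * a3.
Definition wb6 : R := a3 ^+ 2 + 4 * a6.
Definition wb8 : R :=
  a1 ^+ 2 * a6 + 4 * a2 * a6 - a1 * a3 * a4 + a2 * a3 ^+ 2 - a4 ^+ 2.

Definition discriminant : R :=
  - wb2 ^+ 2 * wb8 - 8 * wb4 ^+ 3 - 27 * wb6 ^+ 2 + 9 * wb2 * wb4 * wb6.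

Definition wpoly (x y : R) : R :=
  y ^+ 2 + a1 * x * y + a3 * y - (x ^+ 3 + a2 * x ^+ 2 + a4 * x + a6).

Definition singular_point (x y : R) : Prop :=
  [/\ wpoly x y = 0,
      a1 * y - (3 * x ^+ 2 + 2 * a2 * x + a4) = 0 &
      2 * y + a1 * x + a3 = 0].

End WeierstrassRing.

(* The singular point and its tangent directions are taken over an
   algebraically closed extension L of k. The Taylor expansion of the equation
   at the singular point (x0, y0) is
   ((y-y0) - alpha (x-x0)) ((y-y0) - beta (x-x0)) - (x-x0)^3,
   and the point is a cusp when the tangents coincide: alpha = beta. As L is
   infinite, equality of the values amounts to equality of the polynomials;
   the point at infinity is never singular. *)
Definition has_cusp (k : fieldType) (W : weierstrass k) : Prop :=
  exists (L : closedFieldType) (i : {rmorphism k -> L}) (x0 y0 alpha : L),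
    let WL := map_weierstrass i W in
    singular_point WL x0 y0 /\
    forall x y : L,
      wpoly WL x y = ((y - y0) - alpha * (x - x0)) ^+ 2 - (x - x0) ^+ 3.

Section EllipticCurve.

Variables (F : fieldType) (W : weierstrass F).

Local Notation a1 := (wa1 W).
Local Notation a2 := (wa2 W).
Local Notation a3 := (wa3 W).
Local Notation a4 := (wa4 W).
Local Notation a6 := (wa6 W).

Definition elliptic : Prop := discriminant W != 0.

Inductive point := Infinity | Affine of F & F.

Definition on_curve (P : point) : Prop :=
  if P is Affine x y then wpoly W x y = 0 else True.

Definition add_point (P Q : point) : point :=
  match P, Q with
  | Infinity, _ => Q
  | _, Infinity => P
  | Affine x1 y1, Affine x2 y2 =>
    if (x1 == x2) && (y1 + y2 + a1 * x2 + a3 == 0) then Infinity else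
    let lambda :=
      if x1 == x2
      then (3 * x1 ^+ 2 + 2 * a2 * x1 + a4 - a1 * y1)
             / (2 * y1 + a1 * x1 + a3)
      else (y2 - y1) / (x2 - x1) in
    let nu := y1 - lambda * x1 in
    let x3 := lambda ^+ 2 + a1 * lambda - a2 - x1 - x2 in
    Affine x3 (- (lambda + a1) * x3 - nu - a3)
  end.

Definition mul_point (n : nat) (P : point) : point :=
  iter n (add_point P) Infinity.

(* The equation in (x', y') obtained by substituting
   x = u^2 x' + r and y = u^3 y' + u^2 s x' + t. *)
Definition change_var (u r s t : F) : weierstrass F :=
  Weierstrass
    ((a1 + 2 * s) / u)
    ((a2 - s * a1 + 3 * r - s ^+ 2) / u ^+ 2)
    ((a3 + r * a1 + 2 * t) / u ^+ 3)
    ((a4 - s * a3 + 2 * r * a2 - (t + r * s) * a1 + 3 * r ^+ 2 - 2 * s * t)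
       / u ^+ 4)
    ((a6 + r * a4 + r ^+ 2 * a2 + r ^+ 3 - t * a3 - t ^+ 2 - r * t * a1)
       / u ^+ 6).

End EllipticCurve.

Arguments Infinity {F}.
Arguments Affine {F} _ _.

Section Reduction.

Variables (F : fieldType) (v : valuation F) (E : weierstrass F).

Definition integral_model (W : weierstrass (vring v)) : Prop :=
  exists u r s t : F, u != 0 /\ map_weierstrass val W = change_var E u r s t.

Definition minimal_model (W : weierstrass (vring v)) : Prop :=
  integral_model W /\
  forall W' : weierstrass (vring v), integral_model W' ->
    v (val (discriminant W)) <= v (val (discriminant W')).

(* Any two minimal models are isomorphic over the valuation ring, so the
   choice of W is immaterial. *)
Definition additive_reduction : Prop :=
  exists2 W : weierstrass (vring v), minimal_model W &
    has_cusp (map_weierstrass (@residue F v) W).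

End Reduction.

(* Main.v *)
Require Import Defs.
From mathcomp Require Import all_boot all_order all_algebra all_field.
From mathcomp Require Import ring_quotient generic_quotient.
From mathcomp Require Import ring zify.

(** Suppose that p is not 2, 3, 5 or 7, so that 2, 3, 5 and 7 are units of the
    valuation ring.  Write m for its maximal ideal.  Completing the square and
    the cube turns a minimal model with cuspidal reduction into
    y^2 = x^3 + a x + b with a and b in m, and minimality says that a in m^4
    and b in m^6 do not hold together ([additive_short_model]).  A point
    reduces to the cusp when x lies in m; the others are called smooth.

    A smooth point P other than 0 is not p-torsion.  On the cuspidal cubic y^2 = x^3 the
    function z = x / y identifies the smooth points with the additive group.
    On the given curve, a deformation of the cuspidal one with small a and b,
    the invariant differential integrates to
    L(z) = z + (2/5) a z^5 + (3/7) b z^7 + terms of order at least 2 in (a, b).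
    The displayed truncation is additive modulo m^2, and even modulo m^(k+2)
    among points with z in m^k ([smooth_chord]).  Hence pP = 0 gives
    p L(z(P)) in m^(k+2) with k = v(z(P)); but L(z(P)) has valuation k, and
    v(p) = 1 because K is unramified, so p L(z(P)) has valuation k + 1
    ([smooth_no_torsion]).  One estimate serves both for the points of the
    formal group (k > 0) and for the others (k = 0).

    A point P reducing to the cusp is not p-torsion either.  Conceptually, its
    class in the component group of the Neron model has order 2, 3 or 4, which
    is prime to p.  Concretely, chords show that the position of jP is
    determined by j modulo 2 or 3, in a way that excludes pP = 0.  Three
    patterns occur, [alternating_components], [alternating_roots] and
    [three_components]; comparing the valuations of a, b, x and y as in Tate's
    algorithm shows that one of them applies, or else a lies in m^4 and b in
    m^6 ([singular_no_torsion]). *)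

Set Implicit Arguments.
Unset Strict Implicit.
Unset Printing Implicit Defensive.
Import Order.TTheory GRing.Theory Num.Theory.
Local Open Scope ring_scope.
Local Open Scope quotient_scope.

(** * Powers of the maximal ideal of a valuation ring *)

Section PowersOfMaximalIdeal.
Variables (F : fieldType) (v : valuation F).
Implicit Types (n m k : int) (x y : F).

(** Membership in the n-th power of the maximal ideal, n being any integer. *)
Definition vge n x := (x == 0) || (n <= v x).

Lemma vge0 n : vge n 0. Proof. by rewrite /vge eqxx. Qed.

Lemma vgeW n m x : m <= n -> vge n x -> vge m x.
Proof. by rewrite /vge => mn /orP[->//|nx]; rewrite (le_trans mn nx) orbT. Qed.

Lemma vgeN n x : vge n (- x) = vge n x.
Proof. by rewrite /vge oppr_eq0 valuationN. Qed.

Lemma vgeD n x y : vge n x -> vge n y -> vge n (x + y).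
Proof.
rewrite /vge; have [->|x0] := eqVneq x 0; first by rewrite add0r.
have [->|y0] := eqVneq y 0; first by rewrite addr0 (negPf x0).
have [//|xy0 /= nx ny] := eqVneq (x + y) 0.
by apply: le_trans (valuationD v x0 y0 xy0); rewrite le_min nx ny.
Qed.

Lemma vgeB n x y : vge n x -> vge n y -> vge n (x - y).
Proof. by move=> nx ny; apply: vgeD; rewrite ?vgeN. Qed.

Lemma vgeM n m k x y : vge m x -> vge k y -> n <= m + k -> vge n (x * y).
Proof.
rewrite /vge mulf_eq0; have [//|x0] := eqVneq x 0.
have [//|y0 /= mx ky nmk] := eqVneq y 0.
by rewrite valuationM //; apply: le_trans nmk _; apply: lerD.
Qed.

Lemma vgeMl n x y : vge 0 x -> vge n y -> vge n (x * y).
Proof. by move=> x0 /(vgeM x0)-> //; rewrite add0r. Qed.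

Lemma vgeMr n x y : vge n x -> vge 0 y -> vge n (x * y).
Proof. by move=> nx y0; rewrite mulrC vgeMl. Qed.

Lemma vge_nat (i : nat) : vge 0 i%:R.
Proof.
elim: i => [|i IH]; first exact: vge0.
by rewrite mulrSr vgeD // /vge valuation1 lexx orbT.
Qed.

Lemma vgeX0 x (i : nat) : vge 0 x -> vge 0 (x ^+ i).
Proof.
move=> x0; elim: i => [|i IH]; first by rewrite expr0 (vge_nat 1).
by rewrite exprS vgeMl.
Qed.

Lemma vgeX n x (i : nat) : vge n x -> vge (i%:Z * n) (x ^+ i).
Proof.
move=> nx; elim: i => [|i IH]; first by rewrite expr0 /vge valuation1 mul0r lexx orbT.
by rewrite exprS; apply: vgeM nx IH _; lia.
Qed.

Lemma valuationX x (i : nat) : x != 0 -> v (x ^+ i) = i%:Z * v x.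
Proof.
move=> x0; elim: i => [|i IH]; first by rewrite expr0 valuation1 mul0r.
by rewrite exprS valuationM ?expf_neq0 // IH; lia.
Qed.

Lemma vge_root n m x (i : nat) : (0 < i)%N -> i%:Z * (m - 1) < n ->
  vge n (x ^+ i) -> vge m x.
Proof.
move=> i0 lt; rewrite /vge; have [//|x0] := eqVneq x 0.
rewrite expf_eq0 (negPf x0) andbF /= valuationX //; nia.
Qed.

Lemma nvgeP n x : reflect (x != 0 /\ v x < n) (~~ vge n x).
Proof. by rewrite /vge negb_or -ltNge; apply: andP. Qed.

Lemma nvgeD n x y : vge n y -> ~~ vge n x -> ~~ vge n (x + y).
Proof. by move=> ny; apply: contra => /vgeB/(_ ny); rewrite addrK. Qed.

(** The negation of [vge k x] bounds the valuation of x from above by k - 1, and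
    excludes x = 0; this is how lower bounds get divided by x. *)
Lemma vge_cancel n m k x y : ~~ vge k x -> vge n (x * y) -> m + k <= n + 1 ->
  vge m y.
Proof.
case/nvgeP=> x0 vx; rewrite /vge mulf_eq0 (negPf x0) /=.
have [//|y0] := eqVneq y 0; rewrite valuationM //=; lia.
Qed.

Lemma valuation_perturb x y : x != 0 -> vge (v x + 1) y ->
  x + y != 0 /\ v (x + y) = v x.
Proof.
move=> x0 hy.
have nx : ~~ vge (v x + 1) x by apply/nvgeP; split => //; lia.
have /nvgeP[s0 vs] := nvgeD hy nx; split=> //.
have : vge (v x) (x + y).
  by apply: vgeD; [rewrite /vge lexx orbT | apply: vgeW hy; lia].
rewrite /vge (negPf s0) /=; lia.
Qed.

Lemma unit_perturb x : vge 1 x -> ~~ vge 1 (1 + x).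
Proof.
move=> x1; apply: nvgeD => //; apply/nvgeP.
by rewrite oner_neq0 valuation1.
Qed.

Lemma vge_inv_nat (i : nat) : ~~ vge 1 i%:R -> vge 0 i%:R^-1.
Proof.
move=> ni; apply: (vge_cancel ni (n := 0)) => //.
by case/nvgeP: ni => i0 _; rewrite divff // (vge_nat 1).
Qed.

End PowersOfMaximalIdeal.

(** Proves that a polynomial expression lies in a power of the maximal ideal when
    one factor of each monomial does and the remaining factors are integral. *)
Ltac in_ideal := match goal with
  | H : is_true (vge _ _ ?x) |- is_true (vge _ _ ?x) =>
      first [exact H | apply: vgeW H; first [assumption | done]]
  | |- is_true (vge _ _ 0) => apply: vge0
  | |- is_true (vge _ _ (_%:R)) => apply: vge_nat
  | |- is_true (vge _ _ 1) => apply: (vge_nat _ 1)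
  | |- is_true (vge _ _ (_ + _)) => apply: vgeD; in_ideal
  | |- is_true (vge _ _ (- _)) => rewrite vgeN; in_ideal
  | |- is_true (vge _ _ (_ * _)) =>
      first [apply: vgeMl; in_ideal | apply: vgeMr; in_ideal]
  | |- is_true (vge _ _ (_ ^+ _)) => apply: vgeX0; in_ideal
  end.

(** * Chords of short Weierstrass curves *)

Section ShortChords.

Variables (F : fieldType) (a b : F).

Local Notation W := (Weierstrass 0 0 0 a b).

(** The points (xi, yi) are the three intersections, with multiplicity, of the
    line y = l x + n with y^2 = x^3 + a x + b: the last three equations compare
    the coefficients of x^3 + a x + b - (l x + n)^2 and of the product of the
    x - xi.  They are solved for x3, a and b, so that after substitution l, n,
    x1 and x2 are free and identities about chords become identities of
    rational functions. *)
Record chord (l n x1 y1 x2 y2 x3 y3 : F) : Prop := Chord {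
  chord_y1 : y1 = l * x1 + n;
  chord_y2 : y2 = l * x2 + n;
  chord_y3 : y3 = l * x3 + n;
  chord_e1 : x3 = l ^+ 2 - x1 - x2;
  chord_e2 : a = x1 * x2 + x1 * x3 + x2 * x3 + 2 * l * n;
  chord_e3 : b = n ^+ 2 - x1 * x2 * x3
}.

Inductive add_spec (x1 y1 x2 y2 : F) : point F -> Prop :=
  | AddOpposite of x2 = x1 & y2 = - y1 : add_spec x1 y1 x2 y2 Infinity
  | AddChord l n x3 y3 of chord l n x1 y1 x2 y2 x3 y3 :
      add_spec x1 y1 x2 y2 (Affine x3 (- y3)).

Lemma on_shortE x y : on_curve W (Affine x y) <-> y ^+ 2 = x ^+ 3 + a * x + b.
Proof.
rewrite /= /wpoly /= !mul0r !addr0.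
by split=> [/eqP|->]; [rewrite subr_eq0 => /eqP | apply/eqP; rewrite subr_eq0].
Qed.

(** The group law through chords: this removes the case distinction between
    secants and tangents from all later arguments. *)
Lemma add_shortP x1 y1 x2 y2 :
  on_curve W (Affine x1 y1) -> on_curve W (Affine x2 y2) ->
  add_spec x1 y1 x2 y2 (add_point W (Affine x1 y1) (Affine x2 y2)).
Proof.
rewrite !on_shortE => /= C1 C2; rewrite !mul0r !addr0 !mulr0 !mul0r !subr0 !addr0.
have Eb : b = y1 ^+ 2 - x1 ^+ 3 - a * x1 by rewrite C1; ring.
case: ifPn => [/andP[/eqP <- y12]|].
  by apply: AddOpposite => //; apply/eqP; rewrite -addr_eq0 addrC.
have [Ex /= y12|x12 _] := eqVneq x1 x2.
  rewrite -{}Ex in C2 *.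
  have Ey : y2 = y1.
    apply/eqP; rewrite -subr_eq0; apply/eqP/(mulIf y12); rewrite mul0r.
    have -> : (y2 - y1) * (y1 + y2) = y2 ^+ 2 - y1 ^+ 2 by ring.
    by rewrite C1 C2 subrr.
  rewrite {}Ey {C2} in y12 *.
  have y10 : 2 * y1 != 0 by rewrite mulr_natl mulr2n.
  set l := _ / (2 * y1).
  have Ea : a = l * (2 * y1) - 3 * x1 ^+ 2 by rewrite /l divfK //; ring.
  rewrite (_ : - l * _ - _ = - (l * (l ^+ 2 - x1 - x1) + (y1 - l * x1))); last by ring.
  apply: (@AddChord _ _ _ _ l (y1 - l * x1)); split; try by ring.
    by rewrite {1}Ea; ring.
  by rewrite {1}Eb Ea; ring.
have x21 : x2 - x1 != 0 by rewrite subr_eq0 eq_sym.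
set l := (y2 - y1) / (x2 - x1).
have Ey : y2 = y1 + l * (x2 - x1) by rewrite /l divfK //; ring.
have Ea : a = l * (y1 + y2) - (x1 ^+ 2 + x1 * x2 + x2 ^+ 2).
  apply: (mulIf x21); rewrite mulrBl [l * _ * _]mulrAC /l divfK //.
  have -> : (y2 - y1) * (y1 + y2) = y2 ^+ 2 - y1 ^+ 2 by ring.
  by rewrite C1 C2; ring.
rewrite (_ : - l * _ - _ = - (l * (l ^+ 2 - x1 - x2) + (y1 - l * x1))); last by ring.
apply: (@AddChord _ _ _ _ l (y1 - l * x1)); split; try by ring.
- by rewrite {1}Ey; ring.
- by rewrite {1}Ea Ey; ring.
- by rewrite {1}Eb Ea Ey; ring.
Qed.

Lemma chord_on l n x1 y1 x2 y2 x3 y3 :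
  chord l n x1 y1 x2 y2 x3 y3 -> on_curve W (Affine x3 (- y3)).
Proof. by case=> _ _ Ey Ex Ea Eb; rewrite on_shortE Eb Ea Ey Ex; ring. Qed.

(** The slope in a form that does not degenerate when x1 = x2. *)
Lemma chord_sumr l n x1 y1 x2 y2 x3 y3 : chord l n x1 y1 x2 y2 x3 y3 ->
  l * (y1 + y2) = x1 ^+ 2 + x1 * x2 + x2 ^+ 2 + a.
Proof. by case=> -> -> _ -> -> _; ring. Qed.

Lemma chord_diff l n x1 y1 x2 y2 x3 y3 : chord l n x1 y1 x2 y2 x3 y3 ->
  l * (x2 - x1) = y2 - y1.
Proof. by case=> -> -> _ _ _ _; ring. Qed.

Lemma chord_on_third l n x1 y1 x2 y2 x3 y3 :
  chord l n x1 y1 x2 y2 x3 y3 -> on_curve W (Affine x3 y3).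
Proof.
by move/chord_on; rewrite !on_shortE => <-; rewrite sqrrN.
Qed.

Lemma chord_perm l n x1 y1 x2 y2 x3 y3 : chord l n x1 y1 x2 y2 x3 y3 ->
  chord l n x1 y1 x3 y3 x2 y2.
Proof.
by case=> E1 E2 E3 Ex Ea Eb; split=> //; [rewrite Ex|rewrite Ea|rewrite Eb]; ring.
Qed.

Lemma add_on P Q : on_curve W P -> on_curve W Q -> on_curve W (add_point W P Q).
Proof.
case: P => [|x1 y1] //; case: Q => [|x2 y2] // CP CQ.
by case: (add_shortP CP CQ) => // l n x3 y3 /chord_on.
Qed.

Lemma mul_on k P : on_curve W P -> on_curve W (mul_point W k P).
Proof. by move=> CP; elim: k => //= k; apply: add_on. Qed.

End ShortChords.

(** * The logarithm of the smooth part *)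

(** In the coordinates z = x / y and w = 1 / y, for which infinity is the origin,
    the curve is w = z^3 + a z w^2 + b w^3 and the line y = l x + n is
    w = m z + q with m = - l / n and q = 1 / n.  Substituting gives a cubic in z
    with leading coefficient D. *)
Section ChordAtInfinity.

Variables (F : fieldType) (a b l n x1 y1 x2 y2 x3 y3 : F).
Hypothesis chord123 : chord a b l n x1 y1 x2 y2 x3 y3.
Hypotheses (y10 : y1 != 0) (y20 : y2 != 0).

Let m := - l / n.
Let q := n^-1.
Let D := 1 + a * m ^+ 2 + b * m ^+ 3.

(** The slope of the line in the coordinates (z, w) is a quotient whose
    denominator is congruent to 1 modulo the maximal ideal; cross-multiplied, the
    identity also makes sense when the line passes through the origin of the
    (x, y)-plane, and will show that it does not. *)
Lemma chord_slope :
  l * (1 - a * (x1 / y1) * (y1^-1 + y2^-1)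
         - b * (y1^-1 ^+ 2 + y1^-1 * y2^-1 + y2^-1 ^+ 2)) +
  n * ((x1 / y1) ^+ 2 + x1 / y1 * (x2 / y2) + (x2 / y2) ^+ 2
         + a * y2^-1 ^+ 2) = 0.
Proof.
case: chord123 y10 y20 => -> -> _ E3 Ea Eb y1n y2n; rewrite {}Eb {}Ea {}E3.
by field; rewrite y1n y2n.
Qed.

Hypothesis n0 : n != 0.

(** This excludes y3 = 0 once D is known to be a unit. *)
Lemma chord_prod_y : y1 * y2 * y3 = n ^+ 3 * D.
Proof.
rewrite /D /m; case: chord123 => -> -> -> E3 Ea Eb; rewrite {}Eb {}Ea {}E3.
by field.
Qed.

Lemma chord_w x y : y != 0 -> y = l * x + n -> y^-1 = m * (x / y) + q.
Proof.
move=> yn Ey; apply: (mulIf yn); rewrite mulVf // mulrDl -mulrA divfK //.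
apply: (mulIf n0); rewrite {1}/m /q mulrDl mul1r Ey; by field.
Qed.

Hypothesis y30 : y3 != 0.

(** Vieta's formulas for the cubic in z. *)
Lemma chord_z_sums :
  [/\ (x1 / y1 + x2 / y2 + x3 / y3) * D
        = - (2 * a * m * q + 3 * b * m ^+ 2 * q),
      (x1 / y1 * (x2 / y2) + x1 / y1 * (x3 / y3) + x2 / y2 * (x3 / y3)) * D
        = - m + a * q ^+ 2 + 3 * b * m * q ^+ 2 &
      x1 / y1 * (x2 / y2) * (x3 / y3) * D = q - b * q ^+ 3].
Proof.
rewrite /D /m /q; case: chord123 y10 y20 y30 => -> -> -> E3 Ea Eb.
rewrite {}Eb {}Ea {}E3 => y1n y2n y3n.
split; field; by rewrite n0 y1n y2n y3n.
Qed.

End ChordAtInfinity.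

Section Logarithm.

Variables (F : fieldType) (v : valuation F) (a b : F).
Hypotheses (a1 : vge v 1 a) (b1 : vge v 1 b).
Hypotheses (u5 : ~~ vge v 1 (5%:R : F)) (u7 : ~~ vge v 1 (7%:R : F)).

(** The formal logarithm up to first order in (a, b). *)
Definition flog (z : F) : F := z + 2 / 5 * a * z ^+ 5 + 3 / 7 * b * z ^+ 7.

Lemma flogN z : flog (- z) = - flog z.
Proof. rewrite /flog; ring. Qed.

Let i5 := vge_inv_nat u5.
Let i7 := vge_inv_nat u7.

(** Let e1, e2, e3 be the elementary symmetric functions of z1, z2, z3.  To zeroth
    order in (a, b), e1 = 0, e2 = - m and e3 = q, so Newton's formulas give
    z1^5 + z2^5 + z3^5 = 5 m q and z1^7 + z2^7 + z3^7 = 7 m^2 q.  To first order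
    e1 = - 2 a m q - 3 b m^2 q.  The coefficients 2/5 and 3/7 make the two
    contributions cancel. *)
Lemma flog_sum (k : int) (m q z1 z2 z3 : F) (D := 1 + a * m ^+ 2 + b * m ^+ 3) :
  0 <= k -> vge v 0 m -> vge v k q -> vge v k z1 -> vge v k z2 ->
  vge v 0 z3 ->
  (z1 + z2 + z3) * D = - (2 * a * m * q + 3 * b * m ^+ 2 * q) ->
  (z1 * z2 + z1 * z3 + z2 * z3) * D = - m + a * q ^+ 2 + 3 * b * m * q ^+ 2 ->
  z1 * z2 * z3 * D = q - b * q ^+ 3 ->
  vge v k z3 /\ vge v (k + 2) (flog z1 + flog z2 + flog z3).
Proof.
move=> k0 m0 qk z1k z2k z30.
set e1 := z1 + z2 + z3; set e2 := _ + z2 * z3; set e3 := z1 * z2 * z3.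
move=> E1 E2 E3.
have q0 : vge v 0 q by in_ideal.
have z10 : vge v 0 z1 by in_ideal.
have z20 : vge v 0 z2 by in_ideal.
have uD : ~~ vge v 1 D by rewrite /D -addrA; apply: unit_perturb; in_ideal.
have e3k : vge v k e3 by rewrite /e3; in_ideal.
have e20 : vge v 0 e2 by rewrite /e2; in_ideal.
have k1 : 0 <= k + 1 by exact: ler_wpDr.
have prod j x y : vge v 1 x -> vge v j y -> vge v (j + 1) (x * y).
  by move=> x1 yj; apply: vgeM x1 yj _; rewrite addrC.
have e1k : vge v (k + 1) e1.
  apply: (vge_cancel uD (n := k + 1)); last by rewrite addrC.
  rewrite mulrC E1 (_ : - _ = a * (- 2 * m * q) + b * (- 3 * m ^+ 2 * q)); last by ring.
  by apply: vgeD; apply: prod => //; in_ideal.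
have e2m : vge v 1 (e2 + m).
  apply: (vge_cancel uD (n := 1)) => //.
  rewrite mulrC mulrDl E2 (_ : _ + m * D = a * (q ^+ 2 + m ^+ 3) + b * (3 * m * q ^+ 2 + m ^+ 4));
    last by rewrite /D; ring.
  by in_ideal.
have e3q : vge v (k + 1) (e3 - q).
  apply: (vge_cancel uD (n := k + 1)); last by rewrite addrC.
  rewrite mulrC mulrBl E3.
  rewrite (_ : _ - q * D = (- (b * q ^+ 2 + a * m ^+ 2 + b * m ^+ 3)) * q);
    last by rewrite /D; ring.
  by apply: prod => //; in_ideal.
have e1k' : vge v k e1 by apply: vgeW e1k; rewrite lerDl.
have e10 : vge v 0 e1 by in_ideal.
have e30 : vge v 0 e3 by in_ideal.
have z3k : vge v k z3.
  rewrite (_ : z3 = e1 - z1 - z2); last by rewrite /e1; ring.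
  by in_ideal.
split=> //.
(* Newton's formula for the fifth power sum, rearranged around its main term. *)
have p5 : vge v (k + 1) (z1 ^+ 5 + z2 ^+ 5 + z3 ^+ 5 - 5 * m * q).
  rewrite (_ : _ - _ =
    e1 * (e1 ^+ 4 - 5 * e1 ^+ 2 * e2 + 5 * e2 ^+ 2 + 5 * e1 * e3)
    - (e2 + m) * (5 * e3) + 5 * m * (e3 - q)); last by rewrite /e1 /e2 /e3; ring.
  apply: vgeD; last by in_ideal.
  apply: vgeB; last by apply: prod => //; in_ideal.
  by in_ideal.
(* The same for the seventh power sum. *)
have p7 : vge v (k + 1) (z1 ^+ 7 + z2 ^+ 7 + z3 ^+ 7 - 7 * m ^+ 2 * q).
  rewrite (_ : _ - _ =
    e1 * (e1 ^+ 6 - 7 * e1 ^+ 4 * e2 + 14 * e1 ^+ 2 * e2 ^+ 2 - 7 * e2 ^+ 3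
           + 7 * e1 ^+ 3 * e3 - 21 * e1 * e2 * e3 + 7 * e3 ^+ 2)
    + (e2 + m) * (7 * (e2 - m) * e3) + 7 * m ^+ 2 * (e3 - q));
    last by rewrite /e1 /e2 /e3; ring.
  apply: vgeD; last by in_ideal.
  by apply: vgeD; [in_ideal | apply: prod => //; in_ideal].
have prod2 x y : vge v 1 x -> vge v (k + 1) y -> vge v (k + 2) (x * y).
  by move=> x1 yk; apply: vgeM x1 yk _; clear; lia.
have [/nvgeP[n5 _] /nvgeP[n7 _]] := (u5, u7).
rewrite (_ : _ + flog z3 =
   a * (- m ^+ 2 * e1) + b * (- m ^+ 3 * e1)
   + a * (2 * (5%:R^-1 * (z1 ^+ 5 + z2 ^+ 5 + z3 ^+ 5 - 5 * m * q)))
   + b * (3 * (7%:R^-1 * (z1 ^+ 7 + z2 ^+ 7 + z3 ^+ 7 - 7 * m ^+ 2 * q)))).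
  by repeat (apply: vgeD); apply: prod2 => //; in_ideal.
transitivity (e1 * D - a * m ^+ 2 * e1 - b * m ^+ 3 * e1
  + 2 / 5 * a * (z1 ^+ 5 + z2 ^+ 5 + z3 ^+ 5)
  + 3 / 7 * b * (z1 ^+ 7 + z2 ^+ 7 + z3 ^+ 7)).
  by rewrite /flog /D /e1; ring.
by rewrite E1; field; rewrite n5 n7.
Qed.

End Logarithm.

Section Smooth.

Variables (F : fieldType) (v : valuation F) (a b : F).
Hypotheses (a1 : vge v 1 a) (b1 : vge v 1 b).

Local Notation W := (Weierstrass 0 0 0 a b).

Definition smooth (P : point F) : bool :=
  if P is Affine x _ then ~~ vge v 1 x else true.

(** Since v x <= 0, the term x^3 dominates the right-hand side. *)
Lemma smooth_affine x y : on_curve W (Affine x y) -> ~~ vge v 1 x ->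
  [/\ x != 0, y != 0, v x <= 0 & 2 * v y = 3 * v x].
Proof.
rewrite on_shortE -addrA => C /nvgeP[x0 vx].
have x30 : x ^+ 3 != 0 by rewrite expf_neq0.
have [] := @valuation_perturb _ v (x ^+ 3) (a * x + b) x30.
  rewrite valuationX //; apply: vgeD; last by apply: vgeW b1; lia.
  apply: (@vgeM _ v _ 1 (v x)) => //; last by lia.
  by rewrite /vge lexx orbT.
rewrite -C expf_eq0 /= => y0; rewrite !valuationX //.
Qed.

Lemma smooth_zw x y : on_curve W (Affine x y) -> ~~ vge v 1 x ->
  vge v 0 (x / y) /\ vge v 0 y^-1.
Proof.
move=> C sx; have [x0 y0 vx e] := smooth_affine C sx.
rewrite /vge valuationM ?invr_neq0 // valuationV //.
by split; apply/orP; right; lia.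
Qed.

Lemma singular_y x y : on_curve W (Affine x y) -> vge v 1 x -> vge v 1 y.
Proof.
rewrite on_shortE => C x1; apply: (@vge_root _ v 1 _ _ 2) => //.
have x0 : vge v 0 x by in_ideal.
rewrite C exprS; in_ideal.
Qed.

Lemma smooth_of_w x y : on_curve W (Affine x y) -> y != 0 ->
  vge v 0 y^-1 -> ~~ vge v 1 x.
Proof.
move=> C y0 w0; apply/negP => /(singular_y C).
move: w0; rewrite /vge invr_eq0 (negPf y0) /= valuationV //; lia.
Qed.

(** In the coordinates (z, w) the equation reads
    w (1 - a z w - b w^2) = z^3, with a unit in parentheses. *)
Lemma w_le_z k x y : 0 <= k -> on_curve W (Affine x y) -> y != 0 ->
  vge v 0 y^-1 -> vge v k (x / y) -> vge v k y^-1.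
Proof.
move=> k0; rewrite on_shortE => C y0 w0 zk.
have z0 : vge v 0 (x / y) by in_ideal.
have u : ~~ vge v 1 (1 + (- a * (x / y) * y^-1 - b * y^-1 ^+ 2)).
  by apply: unit_perturb; in_ideal.
apply: (vge_cancel u (n := k)) => //.
have -> : (1 + (- a * (x / y) * y^-1 - b * y^-1 ^+ 2)) * y^-1 = x / y * (x / y) ^+ 2.
  transitivity ((y ^+ 2 - a * x - b) / y ^+ 3); first by field.
  by rewrite C; field.
in_ideal.
Qed.

Hypotheses (u5 : ~~ vge v 1 (5%:R : F)) (u7 : ~~ vge v 1 (7%:R : F)).

(** The value at infinity is the limit of x / y there. *)
Definition zpar (P : point F) : F := if P is Affine x y then x / y else 0.

(** Smooth points are closed under addition, and the logarithm is additive: the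
    line through two smooth points has integral m and q, so the third
    root of the cubic in z is integral as well. *)
Lemma smooth_chord k l n x1 y1 x2 y2 x3 y3 :
  chord a b l n x1 y1 x2 y2 x3 y3 -> 0 <= k ->
  on_curve W (Affine x1 y1) -> on_curve W (Affine x2 y2) ->
  ~~ vge v 1 x1 -> ~~ vge v 1 x2 ->
  vge v k (x1 / y1) -> vge v k (x2 / y2) ->
  [/\ ~~ vge v 1 x3, vge v k (x3 / y3) &
      vge v (k + 2) (flog a b (x1 / y1) + flog a b (x2 / y2) + flog a b (x3 / y3))].
Proof.
move=> ch k0 C1 C2 s1 s2 z1k z2k.
have [_ y10 _ _] := smooth_affine C1 s1; have [_ y20 _ _] := smooth_affine C2 s2.
have [z10 w10] := smooth_zw C1 s1; have [z20 w20] := smooth_zw C2 s2.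
have w1k := w_le_z k0 C1 y10 w10 z1k.
have := chord_slope ch y10 y20.
set U := 1 - _ - _; set V := _ + a * _ => slope.
have uU : ~~ vge v 1 U by rewrite /U -addrA; apply: unit_perturb; in_ideal.
have V0 : vge v 0 V by rewrite /V; in_ideal.
have U0 : U != 0 by case/nvgeP: uU.
have Ey1 := chord_y1 ch.
(* If n vanished, so would l, as U is a unit, and then y1 = l x1 + n. *)
have n0 : n != 0.
  apply: contraNneq y10 => n0; move: slope Ey1; rewrite n0 mul0r !addr0.
  by move/eqP; rewrite mulf_eq0 (negPf U0) orbF => /eqP-> ->; rewrite mul0r.
have mU : U * (- l / n) = V.
  apply: (mulIf n0); rewrite -mulrA divfK // [V * n]mulrC.
  apply/eqP; rewrite -subr_eq0.
  by rewrite (_ : _ - _ = - (l * U + n * V)); [rewrite slope oppr0 | ring].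
have m0 : vge v 0 (- l / n).
  by apply: (vge_cancel uU (n := 0)) => //; rewrite mU.
have Ew x y := @chord_w _ l n n0 x y.
have qk : vge v k n^-1.
  rewrite (_ : n^-1 = y1^-1 - (- l / n) * (x1 / y1)); first by in_ideal.
  by rewrite {1}(Ew x1 y1) //; ring.
have q0 : vge v 0 n^-1 by in_ideal.
have := chord_prod_y ch n0; set D := 1 + _ + _ => prody.
have uD : ~~ vge v 1 D by rewrite /D -addrA; apply: unit_perturb; in_ideal.
have D0 : D != 0 by case/nvgeP: uD.
have y30 : y3 != 0.
  have : y1 * y2 * y3 != 0 by rewrite prody mulf_neq0 ?expf_neq0.
  by rewrite mulf_eq0 negb_or => /andP[].
have [S1 S2 S3] := chord_z_sums ch y10 y20 n0 y30.
have z30 : vge v 0 (x3 / y3).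
  rewrite (_ : x3 / y3 = x1 / y1 + x2 / y2 + x3 / y3 - x1 / y1 - x2 / y2); last by ring.
  apply: vgeB => //; apply: vgeB => //.
  by apply: (vge_cancel uD (n := 0)) => //; rewrite mulrC S1; in_ideal.
have w30 : vge v 0 y3^-1 by rewrite (Ew x3 y3 y30 (chord_y3 ch)); in_ideal.
have [z3k L] := flog_sum a1 b1 u5 u7 k0 m0 qk z1k z2k z30 S1 S2 S3.
split=> //; apply: (smooth_of_w (chord_on ch)); rewrite ?oppr_eq0 //.
by rewrite invrN vgeN.
Qed.

Lemma flog_mul P j (k := v (zpar P)) : on_curve W P -> smooth P -> 0 <= k ->
  [/\ smooth (mul_point W j P), vge v k (zpar (mul_point W j P)) &
   vge v (k + 2) (flog a b (zpar (mul_point W j P)) - j%:R * flog a b (zpar P))].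
Proof.
move=> CP sP k0.
have zP : vge v k (zpar P) by rewrite /vge lexx orbT.
have flog0 : flog a b 0 = 0 by rewrite /flog; ring.
elim: j => [|j [sQ zQ LQ]].
  by split=> //=; rewrite ?flog0 ?mul0r ?subr0 vge0.
have := mul_on j CP; rewrite /mul_point /= -/(mul_point W j P).
rewrite (mulrSr 1 j) mulrDl mul1r.
case: (mul_point W j P) sQ zQ LQ => [|x2 y2] sQ zQ LQ CQ.
  case: (P) CP sP zP LQ => [|x1 y1] CP sP zP LQ /=.
    by rewrite flog0; split; rewrite ?addr0 ?mulr0 ?subr0 ?vge0.
  split=> //; rewrite [X in vge _ _ X](_ : _ = flog a b 0 - j%:R * flog a b (x1 / y1)) //.
  by rewrite flog0 /=; ring.
case: (P) CP sP zP LQ => [|x1 y1] CP sP zP LQ.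
  split=> //; rewrite [X in vge _ _ X](_ : _ = flog a b (x2 / y2) - j%:R * flog a b 0) //.
  by rewrite /= flog0; ring.
case: (add_shortP CP CQ) => [ex ey|l n x3 y3 ch].
  split; rewrite /= ?vge0 //.
  rewrite [X in vge _ _ X](_ : _ = flog a b (x2 / y2) - j%:R * flog a b (x1 / y1)) //.
  rewrite ex ey flog0 invrN mulrN flogN; ring.
have [s3 z3 L3] := smooth_chord ch k0 CP CQ sP sQ zP zQ.
rewrite /= invrN mulrN vgeN flogN; split=> //.
rewrite [X in vge _ _ X](_ : _ = flog a b (x2 / y2) - j%:R * flog a b (x1 / y1)
  - (flog a b (x1 / y1) + flog a b (x2 / y2) + flog a b (x3 / y3))); last by ring.
by apply: vgeB.
Qed.

(** The logarithm of pP lies in the power k + 2 of the maximal ideal, and p times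
    that of P has valuation k + 1. *)
Lemma smooth_no_torsion P (p : nat) : (p%:R : F) != 0 -> v p%:R = 1 ->
  on_curve W P -> smooth P -> mul_point W p P = Infinity -> P = Infinity.
Proof.
move=> p0 vp; case: P => // x y C s pP; exfalso.
have [x0 y0 _ _] := smooth_affine C s.
have [z0 _] := smooth_zw C s.
have zn0 : x / y != 0 by rewrite mulf_neq0 ?invr_neq0.
set k := v (x / y); have k0 : 0 <= k by move: z0; rewrite /vge (negPf zn0).
have [_ _] := flog_mul (P := Affine x y) p C s k0; rewrite pP /= -/k.
rewrite (_ : flog a b 0 - _ = (1 + (a * (2 / 5 * (x / y) ^+ 4) + b * (3 / 7 * (x / y) ^+ 6)))
   * - (p%:R * (x / y))); last by rewrite /flog; ring.
move/(fun h => vge_cancel (n := k + 2) (m := k + 2) _ h).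
have i5 := vge_inv_nat u5; have i7 := vge_inv_nat u7.
have u : ~~ vge v 1 (1 + (a * (2 / 5 * (x / y) ^+ 4) + b * (3 / 7 * (x / y) ^+ 6))).
  by apply: unit_perturb; in_ideal.
move=> /(_ _ u) h; have /h : k + 2 + 1 <= k + 2 + 1 by [].
rewrite vgeN /vge mulf_eq0 (negPf p0) (negPf zn0) /= valuationM // vp -/k.
by clear; lia.
Qed.

End Smooth.

(** * Points reducing to the cusp *)

Section Components.

Local Arguments add_point : simpl never.

Variables (F : fieldType) (v : valuation F) (a b : F).
Hypotheses (a1 : vge v 1 a) (b1 : vge v 1 b).
Hypotheses (u2 : ~~ vge v 1 (2%:R : F)) (u3 : ~~ vge v 1 (3%:R : F)).

Local Notation W := (Weierstrass 0 0 0 a b).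

(** From 2 v(y2) = 3 v(x2) and the dominance of x2 and y2 over x1 and y1,
    2 v(l) = v(x2) <= 0.  That x3 lies in the maximal ideal follows from
    (x1 + x2) x3 = a - 2 l n - x1 x2 with n = y1 - l x1, where every term on the
    right has valuation greater than v(x1 + x2) = v(x2). *)
Lemma singular_add_smooth l n x1 y1 x2 y2 x3 y3 :
  chord a b l n x1 y1 x2 y2 x3 y3 ->
  on_curve W (Affine x1 y1) -> on_curve W (Affine x2 y2) ->
  vge v 1 x1 -> ~~ vge v 1 x2 -> ~~ vge v 1 l /\ vge v 1 x3.
Proof.
move=> ch C1 C2 s1 s2; have y1s := singular_y a1 b1 C1 s1.
have [x20 y20 vx2 e] := smooth_affine a1 b1 C2 s2.
have [xx0 vxx] : x2 - x1 != 0 /\ v (x2 - x1) = v x2.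
  by apply: valuation_perturb; rewrite ?vgeN //; apply: vgeW s1; move: vx2; clear; lia.
have [xp0 vxp] : x2 + x1 != 0 /\ v (x2 + x1) = v x2.
  by apply: valuation_perturb => //; apply: vgeW s1; move: vx2; clear; lia.
have [yy0 vyy] : y2 - y1 != 0 /\ v (y2 - y1) = v y2.
  by apply: valuation_perturb; rewrite ?vgeN //; apply: vgeW y1s; move: vx2 e; clear; lia.
have El := chord_diff ch.
have l0 : l != 0 by apply: contraNneq yy0 => l0; rewrite -El l0 mul0r.
have vl : v l + v x2 = v y2 by rewrite -vyy -vxx -valuationM // El.
split; first by apply/nvgeP; split=> //; move: vl e vx2; clear; lia.
apply: (@vge_cancel _ v (v x2 + 1) 1 (v x2 + 1) (x2 + x1)).
- by apply/nvgeP; split=> //; rewrite vxp; clear; lia.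
- rewrite (_ : _ * x3 = a - 2 * (l * y1) + 2 * (l * l * x1) - x2 * x1); last first.
    by case: ch => -> _ _ _ Ea _; rewrite Ea; ring.
  have lv : vge v (v l) l by rewrite /vge lexx orbT.
  have lv2 : vge v (v l + v l) (l * l) by apply: (vgeM lv lv).
  have v20 := vge_nat v 2.
  apply: vgeB; first (apply: vgeD; first apply: vgeB).
  + by apply: vgeW a1; move: vx2; clear; lia.
  + by apply: vgeMl => //; apply: (vgeM lv y1s); move: vl e vx2; clear; lia.
  + by apply: vgeMl => //; apply: (vgeM lv2 s1); move: vl e vx2; clear; lia.
  + by apply: (vgeM (m := v x2) _ s1) => //; rewrite /vge lexx orbT.
- by clear; lia.
Qed.

(** Because x3 = l^2 - x1 - x2. *)
Lemma singular_add_singular l n x1 y1 x2 y2 x3 y3 :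
  chord a b l n x1 y1 x2 y2 x3 y3 -> vge v 1 x1 -> vge v 1 x2 ->
  vge v 1 x3 = vge v 1 l.
Proof.
move=> ch s1 s2; have -> := chord_e1 ch; apply/idP/idP => [h|h].
  apply: (vge_root (i := 2) (n := 1)) => //.
  by rewrite (_ : l ^+ 2 = l ^+ 2 - x1 - x2 + x1 + x2); [in_ideal | ring].
have h0 : vge v 0 l by in_ideal.
by rewrite exprS expr1; in_ideal.
Qed.

Section SingularPoint.

Variables x1 y1 : F.
Local Notation P := (Affine x1 y1).
Hypotheses (CP : on_curve W P) (sP : vge v 1 x1).

Lemma mulSP j : mul_point W j.+1 P = add_point W P (mul_point W j P).
Proof. by []. Qed.

(** If two points with x in m^d add up to a singular point, the slope l lies in m,
    and l (y1 + y2) = x1^2 + x1 x2 + x2^2 + a puts a into m^(al + 1).  So the sum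
    of two such points is smooth: their component has order 2.  Conversely, adding a
    smooth point to P gives a chord with slope outside m, so that x changes by an
    element of m^al only.  The pairs (al, d) that arise are (1, 1), (2, 2) and
    (3, 2), for the Kodaira types III, I_n^* (including n = 0) and III^*. *)
Lemma alternating_components al d j : 1 <= d -> d <= al -> al < d + d ->
  ~~ vge v (al + 1) a ->
  (forall x y, on_curve W (Affine x y) -> vge v 1 x -> vge v al y) ->
  vge v d x1 ->
  if odd j then exists x y, mul_point W j P = Affine x y /\ vge v d x
  else smooth v (mul_point W j P).
Proof.
move=> d1 dal ald na yal dx1.
elim: j => [|j IH] //; rewrite oddS mulSP; move: (mul_on j CP) IH.
have y1al : vge v al y1 by apply: yal CP sP.
case: (odd j) => /=; last first.
  case: (mul_point W j P) => [|x2 y2] CQ; first by move=> _; exists x1, y1.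
  move=> sQ; case: (add_shortP CP CQ) => [ex|l n x3 y3 ch].
    by move: sQ; rewrite /= ex sP.
  have [nl s3] := singular_add_smooth ch CP CQ sP sQ.
  exists x3, (- y3); split=> //.
  have y3al : vge v al y3 by apply: yal (chord_on_third ch) s3.
  have El := chord_diff (chord_perm ch).
  have : vge v al (x3 - x1).
    by apply: (vge_cancel nl (n := al)) => //; rewrite El; in_ideal.
  by move=> h; rewrite -(subrK x1 x3); apply: vgeD => //; apply: vgeW h.
case: (mul_point W j P) => [|x2 y2] CQ [x [y [//]]] [<- _] {x y} dx2.
have sQ : vge v 1 x2 by in_ideal.
case: (add_shortP CP CQ) => // l n x3 y3 ch.
rewrite /= (singular_add_singular ch) //; apply: contra na => l1.
have y2al : vge v al y2 by apply: yal CQ sQ.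
have dd x x' : vge v d x -> vge v d x' -> vge v (al + 1) (x * x').
  by move=> dx dx'; apply: (vgeM dx dx'); move: ald; clear; lia.
rewrite (_ : a = l * (y1 + y2) - x1 * x1 - x1 * x2 - x2 * x2); last first.
  by rewrite (chord_sumr ch); ring.
do 3![apply: vgeB; last exact: dd].
by apply: (vgeM (m := 1) (k := al)) => //; [in_ideal | rewrite addrC].
Qed.

(** Here x1 has valuation exactly 1, and (x1 + x2) + x3 = l^2 is in m^2 for singular
    points on a line with l in m.  Modulo m^2, adding P to a singular point thus
    exchanges the abscissas x1 and - 2 x1, unless the sum is smooth.  The class
    of P in the component group may have order 2 or 4: for odd j the point jP is
    singular whether or not 2P is smooth. *)
Lemma alternating_roots j : ~~ vge v 2 x1 ->
  (forall x y, on_curve W (Affine x y) -> vge v 1 x -> vge v 2 y) ->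
  if odd j then exists x y, mul_point W j P = Affine x y /\ vge v 2 (x - x1)
  else smooth v (mul_point W j P) \/
    exists x y, mul_point W j P = Affine x y /\ vge v 2 (x + 2 * x1).
Proof.
move=> nx1 y2s.
have n3x1 : ~~ vge v 2 (3 * x1).
  by apply: contra nx1 => h; apply: vge_cancel u3 h _.
have sq l : vge v 1 l -> vge v 2 (l ^+ 2) by move=> l1; apply: (vgeM l1 l1).
elim: j => [|j IH]; first by left.
rewrite oddS mulSP; move: (mul_on j CP) IH.
have y12 : vge v 2 y1 by apply: y2s CP sP.
have v20 := vge_nat v 2.
case: (odd j) => /=; last first.
  case: (mul_point W j P) => [|x2 y2] CQ.
    by move=> _; exists x1, y1; rewrite subrr vge0.
  case=> [sQ|[x [y [[<- _] {x y} x2s]]]].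
    case: (add_shortP CP CQ) => [ex|l n x3 y3 ch].
      by move: sQ; rewrite /= ex sP.
    have [nl s3] := singular_add_smooth ch CP CQ sP sQ.
    exists x3, (- y3); split=> //.
    have y32 : vge v 2 y3 by apply: y2s (chord_on_third ch) s3.
    apply: (vge_cancel nl (n := 2)) => //.
    by rewrite (chord_diff (chord_perm ch)); in_ideal.
  have nx2 : ~~ vge v 2 (x2 - x1).
    apply: contra n3x1 => h.
    by rewrite (_ : 3 * x1 = x2 + 2 * x1 - (x2 - x1)); [in_ideal | ring].
  have sQ : vge v 1 x2.
    rewrite (_ : x2 = x2 + 2 * x1 - 2 * x1); last by ring.
    by in_ideal.
  have y22 : vge v 2 y2 by apply: y2s CQ sQ.
  case: (add_shortP CP CQ) => [ex|l n x3 y3 ch].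
    by move: nx2; rewrite ex subrr vge0.
  exists x3, (- y3); split=> //.
  have l1 : vge v 1 l.
    by apply: (vge_cancel nx2 (n := 2)) => //; rewrite mulrC (chord_diff ch); in_ideal.
  rewrite (chord_e1 ch) (_ : _ - x1 = l ^+ 2 - (x2 + 2 * x1)); last by ring.
  by apply: vgeB => //; apply: sq.
case: (mul_point W j P) => [|x2 y2] CQ [x [y [//]]] [<- _] {x y} dx2.
have sQ : vge v 1 x2.
  by rewrite -(subrK x1 x2); in_ideal.
case: (add_shortP CP CQ) => [|l n x3 y3 ch]; first by left.
have [l1|nl] := boolP (vge v 1 l); last first.
  by left; rewrite /= (singular_add_singular ch).
right; exists x3, (- y3); split=> //.
rewrite (chord_e1 ch) (_ : _ + 2 * x1 = l ^+ 2 - (x2 - x1)); last by ring.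
by apply: vgeB => //; apply: sq.
Qed.

(** All singular points have v(y) = h, and y^2 = b modulo m^(2h + 1), so that y takes
    only two values modulo m^(h + 1), namely y1 and - y1; they distinguish the two
    components other than the identity.  This occurs with h = 1 and h = 2, for
    the Kodaira types IV and IV^*. *)
Lemma three_components (h : int) j : 1 <= h -> vge v (h + 1) a ->
  (forall x y, on_curve W (Affine x y) -> vge v 1 x ->
     vge v h x /\ ~~ vge v (h + 1) y) ->
  match (j %% 3)%N with
  | 0%N => smooth v (mul_point W j P) : Prop
  | 1%N => exists x y, [/\ mul_point W j P = Affine x y, vge v 1 x
                       & vge v (h + 1) (y - y1)]
  | _ => exists x y, [/\ mul_point W j P = Affine x y, vge v 1 x
                       & vge v (h + 1) (y + y1)]
  end.
Proof.
move=> h1 ah sing; have [x1h ny1] := sing _ _ CP sP.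
have n2y1 : ~~ vge v (h + 1) (2 * y1).
  by apply: contra ny1 => hy; apply: vge_cancel u2 hy _.
have Bh x x' : vge v h x -> vge v h x' -> vge v (h + 1) (x ^+ 2 + x * x' + x' ^+ 2 + a).
  have dd z z' : vge v h z -> vge v h z' -> vge v (h + 1) (z * z').
    by move=> hz hz'; apply: (vgeM hz hz'); rewrite lerD2l.
  by move=> hx hx'; rewrite !expr2; do ![apply: vgeD] => //; apply: dd.
elim: j => [|j IH] //; rewrite mulSP; move: (mul_on j CP) IH.
have step : (j.+1 %% 3 = if j %% 3 == 0 then 1 else if j %% 3 == 1 then 2 else 0)%N.
  by case: ifP => [/eqP|/eqP]; [|case: ifP => [/eqP|/eqP]]; lia.
have : (j %% 3 < 3)%N by rewrite ltn_mod.
rewrite {}step; case: (j %% 3)%N => [|[|[|//]]] _ /=.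
- case: (mul_point W j P) => [|x2 y2] CQ.
    by move=> _; exists x1, y1; rewrite subrr vge0.
  move=> sQ; case: (add_shortP CP CQ) => [ex|l n x3 y3 ch].
    by move: sQ; rewrite /= ex sP.
  have [nl s3] := singular_add_smooth ch CP CQ sP sQ.
  have [x3h _] := sing _ _ (chord_on ch) s3.
  exists x3, (- y3); split=> //; rewrite -opprD vgeN (addrC y3).
  apply: (vge_cancel nl (n := h + 1)) => //.
  by rewrite (chord_sumr (chord_perm ch)) Bh.
- case: (mul_point W j P) => [|x2 y2] CQ [x [y [//]]] [<- <-] {x y} sQ y2h.
  have [x2h _] := sing _ _ CQ sQ.
  have nyy : ~~ vge v (h + 1) (y1 + y2).
    apply: contra n2y1 => hy.
    by rewrite (_ : 2 * y1 = y1 + y2 - (y2 - y1)); [in_ideal | ring].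
  case: (add_shortP CP CQ) => [_ ey|l n x3 y3 ch].
    by move: nyy; rewrite ey subrr vge0.
  have l1 : vge v 1 l.
    apply: (vge_cancel nyy (n := h + 1)); last by clear; lia.
    by rewrite mulrC (chord_sumr ch) Bh.
  have s3 : vge v 1 x3 by rewrite (singular_add_singular ch).
  have [x3h _] := sing _ _ (chord_on ch) s3.
  exists x3, (- y3); split=> //.
  rewrite (_ : - y3 + y1 = - (y3 - y1)); last by ring.
  rewrite vgeN -(chord_diff (chord_perm ch)).
  by apply: (vgeM (m := 1) (k := h)) => //; [in_ideal | rewrite addrC].
- case: (mul_point W j P) => [|x2 y2] CQ [x [y [//]]] [<- <-] {x y} sQ y2h.
  have [x2h _] := sing _ _ CQ sQ.
  case: (add_shortP CP CQ) => // l n x3 y3 ch.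
  rewrite /= (singular_add_singular ch) //; apply: contra n2y1 => l1.
  rewrite (_ : 2 * y1 = y2 + y1 - (y2 - y1)); last by ring.
  apply: vgeB => //; rewrite -(chord_diff ch).
  by apply: (vgeM (m := 1) (k := h)) => //; [in_ideal | rewrite addrC].
Qed.

(** The valuations of a and b are raised step by step, as in Tate's algorithm; at
    each step that cannot be taken, one of the three patterns applies. *)
Lemma singular_no_torsion p : ~~ (vge v 4 a && vge v 6 b) ->
  odd p -> ~~ (3 %| p)%N -> mul_point W p P <> Infinity.
Proof.
move=> min oddp p3 pP.
have curve x y : on_curve W (Affine x y) ->
  y ^+ 2 = x ^+ 3 + a * x + b /\ b = y ^+ 2 - x ^+ 3 - a * x.
  by rewrite on_shortE => Cxy; split=> //; rewrite Cxy; ring.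
have cube i x : vge v i x -> vge v (3%:Z * i) (x ^+ 3) by apply: vgeX.
have sqr i x : vge v i x -> vge v (2%:Z * i) (x ^+ 2) by apply: vgeX.
have mul i j x y : vge v i x -> vge v j y -> vge v (i + j) (x * y).
  by move=> ix jy; apply: (vgeM ix jy).
have y1s := singular_y a1 b1 CP sP.
have alt al d : 1 <= d -> d <= al -> al < d + d -> ~~ vge v (al + 1) a ->
  (forall x y, on_curve W (Affine x y) -> vge v 1 x -> vge v al y) ->
  vge v d x1 -> False.
  move=> d1 da ad na ya dx.
  have := alternating_components p d1 da ad na ya dx.
  by rewrite oddp pP => -[x [y []]].
have three h : 1 <= h -> vge v (h + 1) a ->
  (forall x y, on_curve W (Affine x y) -> vge v 1 x ->
     vge v h x /\ ~~ vge v (h + 1) y) -> False.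
  move=> h1 ha sing; have := three_components p h1 ha sing.
  move: p3; rewrite /dvdn pP; case: (p %% 3)%N => // -[|r] _ [x [y []]] //.
have sqrty i (n : int) y : vge v n (y ^+ 2) -> 2%:Z * (i - 1) < n -> vge v i y.
  by move=> hy lt; apply: (vge_root (i := 2) (n := n)).
have ax i j x : vge v i a -> vge v 1 x -> j <= i + 1 -> vge v j (a * x).
  by move=> ia x1s; apply: vgeM ia x1s.
have x3s j x : vge v 1 x -> j <= 3 -> vge v j (x ^+ 3).
  by move=> /cube h lt; apply: vgeW h.
(* Type III when a has valuation 1. *)
have [a2|na2] := boolP (vge v 2 a); last first.
  by apply: (alt 1 1) => // x y; apply: singular_y.
have b2 : vge v 2 b.
  have [_ ->] := curve _ _ CP; apply: vgeB; last exact: ax a2 sP _.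
  by apply: vgeB; [apply: vgeW (sqr _ _ y1s) | apply: x3s].
(* Type IV when b has valuation 2. *)
have [b3|nb3] := boolP (vge v 3 b); last first.
  apply: (three 1) => // x y Cxy xs; split=> //.
  apply: contra nb3 => ys; have [_ ->] := curve _ _ Cxy.
  apply: vgeB; last exact: ax a2 xs _.
  by apply: vgeB; [apply: vgeW (sqr _ _ ys) | apply: x3s].
have sing2 x y : on_curve W (Affine x y) -> vge v 1 x -> vge v 2 y.
  move=> Cxy xs; have [Ey _] := curve _ _ Cxy.
  apply: (sqrty 2 3) => //; rewrite Ey; apply: vgeD => //.
  by apply: vgeD; [apply: x3s | apply: ax a2 xs _].
(* Type I_n^*, where x / u reduces to a non-zero root of the cubic
   T^3 + (a / u^2) T + b / u^3 for a uniformizer u. *)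
have [x12|nx12] := boolP (vge v 2 x1); last first.
  have := alternating_roots p nx12 sing2.
  by rewrite oddp pP => -[x [y []]].
have b4 : vge v 4 b.
  have [_ ->] := curve _ _ CP; apply: vgeB; last exact: vgeM a2 x12 _.
  by apply: vgeB; [apply: sqr (sing2 _ _ CP sP) | apply: vgeW (cube _ _ x12)].
(* Type I_n^* again, with x / u reducing to the simple root 0. *)
have [a3|na3] := boolP (vge v 3 a); last exact: (alt 2 2).
have sing2x x y : on_curve W (Affine x y) -> vge v 1 x -> vge v 2 x.
  move=> Cxy xs; have [Ey _] := curve _ _ Cxy.
  apply: (vge_root (i := 3) (n := 4)) => //.
  rewrite (_ : x ^+ 3 = y ^+ 2 - a * x - b); last by rewrite Ey; ring.
  apply: vgeB => //; apply: vgeB; last exact: ax a3 xs _.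
  by apply: (sqr 2); apply: sing2 Cxy xs.
(* Type IV^* when b has valuation 4. *)
have [b5|nb5] := boolP (vge v 5 b); last first.
  apply: (three 2) => // x y Cxy xs; have xs2 := sing2x _ _ Cxy xs; split=> //.
  apply: contra nb5 => ys; have [_ ->] := curve _ _ Cxy.
  apply: vgeB; last exact: vgeM a3 xs2 _.
  by apply: vgeB; [apply: vgeW (sqr _ _ ys) | apply: vgeW (cube _ _ xs2)].
have sing3 x y : on_curve W (Affine x y) -> vge v 1 x -> vge v 3 y.
  move=> Cxy xs; have [Ey _] := curve _ _ Cxy; have xs2 := sing2x _ _ Cxy xs.
  apply: (sqrty 3 5) => //; rewrite Ey; apply: vgeD => //.
  by apply: vgeD; [apply: vgeW (cube _ _ xs2) | apply: (vgeM a3 xs2)].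
(* Type III^* when a has valuation 3. *)
have [a4|na4] := boolP (vge v 4 a); last exact: (alt 3 2).
move: min; rewrite a4 /=; apply/negP; rewrite negbK.
have [_ ->] := curve _ _ CP; apply: vgeB; last exact: vgeM a4 x12 _.
by apply: vgeB; [apply: (sqr 3); apply: sing3 CP sP | apply: (cube 2)].
Qed.

End SingularPoint.
End Components.

(** * Changes of variables and the short model *)

Section ChangeOfVariables.

Variable F : fieldType.
Implicit Types (E : weierstrass F) (u r s t : F).

Lemma weierstrass_eq E E' : wa1 E = wa1 E' -> wa2 E = wa2 E' -> wa3 E = wa3 E' ->
  wa4 E = wa4 E' -> wa6 E = wa6 E' -> E = E'.
Proof. by case: E E' => [????? []] /= ????? -> -> -> -> ->. Qed.

Lemma change_var_comp E u r s t u' r' s' t' : u != 0 -> u' != 0 ->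
  change_var (change_var E u r s t) u' r' s' t' =
  change_var E (u * u') (u ^+ 2 * r' + r) (u * s' + s)
    (u ^+ 3 * t' + u ^+ 2 * s * r' + t).
Proof.
by move=> u0 u'0; apply: weierstrass_eq => /=; field; rewrite u0 u'0.
Qed.

Lemma discriminant_change_var E u r s t : u != 0 ->
  discriminant (change_var E u r s t) = discriminant E / u ^+ 12.
Proof.
by move=> u0; rewrite /discriminant /wb2 /wb4 /wb6 /wb8 /=; field.
Qed.

(** The substitution behind [change_var], carrying points of the new curve to points
    of the old one. *)
Definition unchange u r s t (P : point F) : point F :=
  if P is Affine x y then Affine (u ^+ 2 * x + r) (u ^+ 3 * y + u ^+ 2 * s * x + t)
  else Infinity.

Lemma unchange_surj u r s t P : u != 0 -> exists Q, P = unchange u r s t Q.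
Proof.
move=> u0; case: P => [|x y]; first by exists Infinity.
exists (Affine ((x - r) / u ^+ 2) ((y - s * (x - r) - t) / u ^+ 3)).
by congr Affine; field.
Qed.

Lemma wpoly_change_var E u r s t x y : u != 0 ->
  wpoly E (u ^+ 2 * x + r) (u ^+ 3 * y + u ^+ 2 * s * x + t) =
  u ^+ 6 * wpoly (change_var E u r s t) x y.
Proof. by move=> u0; rewrite /wpoly /=; field. Qed.

Lemma on_curve_unchange E u r s t P : u != 0 ->
  on_curve E (unchange u r s t P) -> on_curve (change_var E u r s t) P.
Proof.
case: P => [|x y] //= u0; rewrite wpoly_change_var // => /eqP.
by rewrite mulf_eq0 expf_eq0 (negPf u0) andbF => /eqP.
Qed.

(** The points have to lie on the curve: otherwise the denominator of the tangent
    slope may vanish although the points are not opposite. *)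
Lemma add_point_unchange E u r s t P Q (E' := change_var E u r s t) : u != 0 ->
  on_curve E' P -> on_curve E' Q ->
  add_point E (unchange u r s t P) (unchange u r s t Q) =
  unchange u r s t (add_point E' P Q).
Proof.
move=> u0; case: P => [|x1 y1] //; case: Q => [|x2 y2] // C1 C2.
have u20 : u ^+ 2 != 0 by rewrite expf_neq0.
have u30 : u ^+ 3 != 0 by rewrite expf_neq0.
have ex : (u ^+ 2 * x1 + r == u ^+ 2 * x2 + r) = (x1 == x2).
  by rewrite (inj_eq (addIr r)) (inj_eq (mulfI u20)).
rewrite /add_point /unchange ex.
have [Ex|x12] := eqVneq x1 x2; last first.
  have x21 : x2 - x1 != 0 by rewrite subr_eq0 eq_sym.
  have -> : u ^+ 2 * x2 + r - (u ^+ 2 * x1 + r) = u ^+ 2 * (x2 - x1) by ring.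
  by congr Affine; rewrite /E' /=; field; rewrite u0 x21.
rewrite -Ex in C2 *; rewrite !andTb.
set c := y1 + y2 + _ + _.
have -> : (u ^+ 3 * y1 + u ^+ 2 * s * x1 + t + (u ^+ 3 * y2 + u ^+ 2 * s * x1 + t)
  + wa1 E * (u ^+ 2 * x1 + r) + wa3 E) = u ^+ 3 * c.
  by rewrite /c /E' /=; field.
rewrite mulf_eq0 (negPf u30) /=.
have [//|c0] := eqVneq c 0.
have Ey : y2 = y1.
  apply/eqP; rewrite -subr_eq0; apply/eqP/(mulIf c0); rewrite mul0r.
  have -> : (y2 - y1) * c = wpoly E' x1 y2 - wpoly E' x1 y1 by rewrite /c /wpoly; ring.
  by move: C1 C2 => /= -> ->; rewrite subrr.
have d0 : 2 * y1 + wa1 E' * x1 + wa3 E' != 0.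
  by move: c0; rewrite /c Ey; apply: contraNneq => <-; apply/eqP; ring.
have d1 : 2 * (u ^+ 3 * y1 + u ^+ 2 * s * x1 + t) + wa1 E * (u ^+ 2 * x1 + r) + wa3 E
   = u ^+ 3 * (2 * y1 + wa1 E' * x1 + wa3 E') by rewrite /E' /=; field.
rewrite d1 /E' /= in d0 *.
congr Affine; field; rewrite u0 /=;
  rewrite (_ : _ + _ = u ^+ 3 * (2 * y1 + (wa1 E + 2 * s) / u * x1
            + (wa3 E + r * wa1 E + 2 * t) / u ^+ 3)) ?mulf_neq0 //; by field.
Qed.

End ChangeOfVariables.

Section ShortModel.

Variable F : fieldType.

(** The invariants c4 and c6; they vanish together exactly at the cuspidal cubics
    among the singular ones. *)
Definition wc4 (R : comNzRingType) (W : weierstrass R) : R :=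
  wb2 W ^+ 2 - 24 * wb4 W.

Definition wc6 (R : comNzRingType) (W : weierstrass R) : R :=
  - wb2 W ^+ 3 + 36 * wb2 W * wb4 W - 216 * wb6 W.

Lemma short_model (W : weierstrass F) : (2%:R : F) != 0 -> (3%:R : F) != 0 ->
  exists r s t : F, change_var W 1 r s t =
    Weierstrass 0 0 0 (- (wc4 W / 48)) (- (wc6 W / 864)).
Proof.
move=> n2 n3.
have n12 : (12%:R : F) != 0 by rewrite (natrM F 4 3) (natrM F 2 2) !mulf_neq0.
have n48 : (48%:R : F) != 0 by rewrite (natrM F 4 12) (natrM F 2 2) !mulf_neq0.
have n864 : (864%:R : F) != 0.
  by rewrite (natrM F 18 48) (natrM F 6 3) (natrM F 2 3) !mulf_neq0.
set r := - wb2 W / 12.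
exists r, (- wa1 W / 2), (- (wa3 W + r * wa1 W) / 2).
rewrite /r /wc4 /wc6 /wb2 /wb4 /wb6.
by apply: weierstrass_eq => /=; field; rewrite ?n2 ?n12 ?n48 ?n864 ?oner_neq0.
Qed.

(** Evaluating the two sides of the Taylor expansion at (0, 0), (1, 0), (-1, 0),
    (0, 1) and (1, 1) determines all coefficients in terms of the cusp and its
    tangent. *)
Lemma cusp_c4_c6 (W : weierstrass F) : (2%:R : F) != 0 -> has_cusp W ->
  wc4 W = 0 /\ wc6 W = 0.
Proof.
move=> n2 [L [i [x0 [y0 [al [_ cusp]]]]]].
have L2 : (2%:R : L) != 0 by rewrite -(rmorph_nat i) fmorph_eq0.
set WL := map_weierstrass i W in cusp.
have [E4 E6] : wc4 WL = i (wc4 W) /\ wc6 WL = i (wc6 W).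
  by rewrite /wc4 /wc6 /wb2 /wb4 /wb6 /=; split; ring.
set be := y0 - al * x0.
pose w := wpoly WL.
have A1 : wa1 WL = - 2 * al.
  transitivity (w 1 1 - w 1 0 - w 0 1 + w 0 0); first by rewrite /w /wpoly; ring.
  by rewrite /w !cusp; ring.
have A2 : wa2 WL = - (al ^+ 2 + 3 * x0).
  apply: (mulfI L2); transitivity (2 * w 0 0 - w 1 0 - w (-1) 0).
    by rewrite /w /wpoly; ring.
  by rewrite /w !cusp; ring.
have A3 : wa3 WL = - 2 * be.
  transitivity (w 0 1 - w 0 0 - 1); first by rewrite /w /wpoly; ring.
  by rewrite /w !cusp /be; ring.
have A4 : wa4 WL = 3 * x0 ^+ 2 - 2 * al * be.
  apply: (mulfI L2); transitivity (w (-1) 0 - w 1 0 - 2).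
    by rewrite /w /wpoly; ring.
  by rewrite /w !cusp /be; ring.
have A6 : wa6 WL = - (be ^+ 2 + x0 ^+ 3).
  transitivity (- w 0 0); first by rewrite /w /wpoly; ring.
  by rewrite /w !cusp /be; ring.
split; apply/eqP; rewrite -(fmorph_eq0 i) -?E4 -?E6; apply/eqP;
  rewrite /wc4 /wc6 /wb2 /wb4 /wb6 A1 A2 A3 A4 ?A6; ring.
Qed.

End ShortModel.

(** * Minimal models and the torsion points of an unramified field *)

Section MinimalModels.

Variables (F : fieldType) (v : valuation F).
Hypothesis v_normalized : normalized v.
Hypotheses (u2 : ~~ vge v 1 (2%:R : F)) (u3 : ~~ vge v 1 (3%:R : F)).

Lemma residue_eq0 (x : vring v) : residue x = 0 -> vge v 1 (val x).
Proof.
move/eqP; rewrite /residue -(rmorph0 (\pi_{ideal_quot (@vmax_pred _ v)})).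
rewrite piE Quotient.equivE subr0 unfold_in /vmax_pred /vge.
by case: eqP.
Qed.

(** The valuations of c4 and c6 are positive because their residues vanish at a
    cusp.  If a and b were in m^4 and m^6, dividing x and y by the square and the
    cube of a uniformizer would give an integral model whose discriminant has
    valuation smaller by 12. *)
Lemma additive_short_model (E : weierstrass F) : elliptic E ->
  additive_reduction v E ->
  exists u r s t a b : F, [/\ u != 0, change_var E u r s t = Weierstrass 0 0 0 a b,
    vge v 1 a, vge v 1 b & ~~ (vge v 4 a && vge v 6 b)].
Proof.
move=> ellE [W [[u [r [s [t [u0 EW]]]]] minW] cusp].
have [[n2 _] [n3 _]] := (nvgeP _ _ _ u2, nvgeP _ _ _ u3).
have r2 : (2%:R : residue_field v) != 0.
  rewrite -(rmorph_nat (@residue F v)); apply: contra u2 => /eqP/residue_eq0.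
  by rewrite rmorph_nat.
have [c4 c6] := cusp_c4_c6 r2 cusp.
have C4 : vge v 1 (wc4 (map_weierstrass val W)).
  rewrite (_ : wc4 _ = val (wc4 W)); last by rewrite /wc4 /wb2 /wb4 /=; ring.
  apply: residue_eq0; rewrite -c4 /wc4 /wb2 /wb4 /=; ring.
have C6 : vge v 1 (wc6 (map_weierstrass val W)).
  rewrite (_ : wc6 _ = val (wc6 W)); last by rewrite /wc6 /wb2 /wb4 /wb6 /=; ring.
  apply: residue_eq0; rewrite -c6 /wc6 /wb2 /wb4 /wb6 /=; ring.
have [r' [s' [t' short]]] := short_model (map_weierstrass val W) n2 n3.
move: short; set a := - _; set b := - _ => short.
have unitM x y : ~~ vge v 1 x -> ~~ vge v 1 y -> ~~ vge v 1 (x * y).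
  by move=> ux; apply: contra => h; apply: (vge_cancel ux h).
have u12 : ~~ vge v 1 (12%:R : F) by rewrite (natrM F 4 3) (natrM F 2 2) !unitM.
have u48 : ~~ vge v 1 (48%:R : F) by rewrite (natrM F 4 12) (natrM F 2 2) !unitM.
have u864 : ~~ vge v 1 (864%:R : F).
  by rewrite (natrM F 18 48) (natrM F 6 3) (natrM F 2 3) !unitM.
have a1 : vge v 1 a by rewrite vgeN; apply: vgeMr => //; apply: vge_inv_nat.
have b1 : vge v 1 b by rewrite vgeN; apply: vgeMr => //; apply: vge_inv_nat.
have one0 := oner_neq0 F.
move: (short); rewrite {1}EW change_var_comp // mulr1.
set r0 := _ + r; set s0 := _ + s; set t0 := _ + t => shortE.
exists u, r0, s0, t0, a, b; split=> //; apply/negP => /andP[a4 b6].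
have [w w0 vw] := v_normalized 1.
have vwX k : ~~ vge v (k%:Z + 1) (w ^+ k).
  apply/nvgeP; rewrite expf_neq0 // valuationX // vw mulr1; split=> //.
  by clear; lia.
have aV : a / w ^+ 4 \in @vint_pred F v.
  have: vge v 0 (a / w ^+ 4) by apply: (vge_cancel (vwX 4) (n := 4)); rewrite // mulrC divfK ?expf_neq0.
  by [].
have bV : b / w ^+ 6 \in @vint_pred F v.
  have: vge v 0 (b / w ^+ 6) by apply: (vge_cancel (vwX 6) (n := 6)); rewrite // mulrC divfK ?expf_neq0.
  by [].
pose W' : weierstrass (vring v) := Weierstrass 0 0 0 (VRing aV) (VRing bV).
have EW' : map_weierstrass val W' = change_var (Weierstrass 0 0 0 a b) w 0 0 0.
  by apply: weierstrass_eq => /=; field.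
have /minW : integral_model E W'.
  rewrite /integral_model EW' -shortE change_var_comp //.
  by do 4![eexists]; split; last reflexivity; rewrite mulf_neq0.
have disc V : val (discriminant V) = discriminant (map_weierstrass (val : vring v -> F) V).
  by rewrite /discriminant /wb2 /wb4 /wb6 /wb8 /=; ring.
rewrite !disc EW' -short EW !discriminant_change_var //.
set d := discriminant E / _.
have d0 : d != 0 by rewrite mulf_neq0 ?invr_neq0 ?expf_neq0.
have w12 : w ^+ 12 != 0 by rewrite expf_neq0.
rewrite expr1n divr1 (valuationM v d0 (invr_neq0 w12)) (valuationV v w12).
by rewrite (valuationX v _ w0) vw; clear; lia.
Qed.

End MinimalModels.

Lemma mul_point_unchange (F : fieldType) (E : weierstrass F) (a b u r s t : F) j P
    (W := Weierstrass 0 0 0 a b) : u != 0 ->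
  change_var E u r s t = W -> on_curve W P ->
  mul_point E j (unchange u r s t P) = unchange u r s t (mul_point W j P).
Proof.
move=> u0 EW CP; elim: j => //= j IH.
rewrite /mul_point /= -/(mul_point _ _ _) -/(mul_point _ _ _) IH.
by rewrite add_point_unchange ?EW //; apply: mul_on.
Qed.

Section Unramified.

Variables (p : nat) (Qp : padicField p) (K : fieldExtType Qp) (v : valuation K).
Hypothesis unr : has_ramification_index v 1.

Lemma unramified_nat (i : nat) : (0 < i)%N ->
  (i%:R : K) != 0 /\ v i%:R = (logn p i)%:Z.
Proof.
move=> i0.
have q0 : (i%:R : rat) != 0 by rewrite pnatr_eq0 -lt0n.
have Qi : (i%:R : Qp) != 0 by rewrite -(rmorph_nat (padic_of_rat Qp)) fmorph_eq0.
have Ki : (i%:R : Qp)%:A = i%:R :> K by rewrite scaler_nat.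
split; first by rewrite -Ki scaler_eq0 negb_or Qi oner_neq0.
rewrite -Ki unr // mul1r -(rmorph_nat (padic_of_rat Qp)) padic_of_rat_val //.
have -> : (i%:R : rat) = i%:Z%:Q by rewrite pmulrn.
by rewrite /padic_val numq_int denq_int logn1 subr0.
Qed.

Hypotheses (p_prime : prime p) (v_normalized : normalized v).

Lemma additive_no_torsion (E : weierstrass K) (P : point K) :
  p != 2 -> p != 3 -> p != 5 -> p != 7 ->
  elliptic E -> additive_reduction v E -> on_curve E P ->
  mul_point E p P = Infinity -> P = Infinity.
Proof.
move=> p2 p3 p5 p7 E_elliptic addE P_on_E P_torsion.
have unit q : prime q -> p != q -> ~~ vge v 1 (q%:R : K).
  move=> qp pq; have [q0 vq] := unramified_nat (prime_gt0 qp).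
  by apply/nvgeP; split; rewrite // vq lognE p_prime prime_gt0 // dvdn_prime2 // (negPf pq).
have [p0 vp] := unramified_nat (prime_gt0 p_prime).
have lp : logn p p = 1%N := pfactorK 1 p_prime; rewrite {}lp in vp.
have [u2 u3 u5 u7] := And4 (unit 2 isT p2) (unit 3 isT p3) (unit 5 isT p5) (unit 7 isT p7).
have [u [r [s [t [a [b [u0 EW a1 b1 min]]]]]]] :=
  additive_short_model v_normalized u2 u3 E_elliptic addE.
have [Q defP] := unchange_surj r s t P u0.
have CQ : on_curve (Weierstrass 0 0 0 a b) Q.
  by rewrite -EW; apply: on_curve_unchange => //; rewrite -defP.
have pQ : mul_point (Weierstrass 0 0 0 a b) p Q = Infinity.
  move: P_torsion; rewrite defP (mul_point_unchange _ u0 EW CQ).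
  by case: mul_point.
have [sQ|] := boolP (smooth v Q).
  by rewrite defP (smooth_no_torsion a1 b1 u5 u7 p0 vp CQ sQ pQ).
case: Q CQ pQ {defP} => // x y CQ pQ; rewrite negbK => sQ.
case: (singular_no_torsion a1 b1 u2 u3 CQ sQ min _ _ pQ).
  by case/even_prime: p_prime p2 => [->|].
by rewrite dvdn_prime2 // eq_sym.
Qed.

End Unramified.

Local Close Scope quotient_scope.
Local Close Scope ring_scope.

Theorem theorem6p9 (p : nat) (p_prime : prime p)
    (Qp : padicField p) (K : fieldExtType Qp)
    (vK : valuation K) (vK_normalized : normalized vK)
    (vK_unramified : has_ramification_index vK 1)
    (E : weierstrass K) (E_elliptic : elliptic E)
    (P : point K) (P_on_E : on_curve E P) (P_nontrivial : P <> Infinity)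
    (P_torsion : mul_point E p P = Infinity) :
  additive_reduction vK E -> [\/ p = 2, p = 3, p = 5 | p = 7].
Proof.
move=> addE.
have [->|p2] := eqVneq p 2; first by constructor 1.
have [->|p3] := eqVneq p 3; first by constructor 2.
have [->|p5] := eqVneq p 5; first by constructor 3.
have [->|p7] := eqVneq p 7; first by constructor 4.
case: P_nontrivial.
exact: (additive_no_torsion vK_unramified p_prime vK_normalized p2 p3 p5 p7
          E_elliptic addE P_on_E P_torsion).
Qed.
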